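(* Let $k$ be an algebraically closed field of characteristic $2$, let $M\geq 2$, and let $X=V(f,g)\subset\mathbb{P}^{2M+1}_k$, where in coordinates $[x_0:\dots:x_M:y_0:\dots:y_M]$ $$f=\sum_{i=0}^M a_ix_iy_i,\qquad g=\sum_{i=0}^M \left(b_ix_iy_i+x_i^2+y_i^2\right),$$ with $a_i,b_i\in k$, $a_i\neq0$ for all $i$, and $a_ib_j-a_jb_i\neq0$ for all $i\neq j$. Let $\zeta\in\mathrm{PGL}_2(k)$ be an automorphism of $\mathbb{P}^1_k$ sending the set $\varphi(Z)=\{[a_i:b_i]:0\le i\le M\}$ to itself, and let $\tau\in S_{M+1}$ be the permutation of $\{0,\dots,M\}$ with $\zeta\cdot[a_i:b_i]=[a_{\tau(i)}:b_{\tau(i)}]$ for all $i$. Choose a matrix $A\in\mathrm{GL}_2(k)$ representing $\zeta$, and let $\lambda_i\in k^\times$ be the scalars such that $$A\begin{bmatrix}a_i\\ b_i\end{bmatrix}=\lambda_i\begin{bmatrix}a_{\tau(i)}\\ b_{\tau(i)}\end{bmatrix}\qquad(0\le i\le M).$$ Then $\zeta$ is in the image of $\varphi_*:\pi_0(\mathrm{Aut}_X)\to\mathrm{PGL}_2(k)$ if and only if the following two conditions hold: (1) $\det A=\dfrac{a_{\tau(i)}\lambda_i^2}{a_i}$ for all $0\leq i\leq M$; (2) for each $0\leq j\leq M$, the value $$\frac{a_{\tau(i)}(\lambda_i-\lambda_j)}{a_{\tau(i)}b_{\tau(j)}-a_{\tau(j)}b_{\tau(i)}}$$ is independent of $i$,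 for $i\neq j$.
   Context: $X$ is smooth, and its automorphism group scheme $\mathrm{Aut}_X$ is finite and is a closed subgroup scheme of $\mathrm{PGL}_{2M+2}$. $\pi_0(\mathrm{Aut}_X)=\mathrm{Aut}_X/\mathrm{Aut}^0_X$ is identified with the group $\mathrm{Aut}_X(k)$. $\varphi:\mathbb{P}^{2M+1}_k\setminus X\to\mathbb{P}^1_k$ is the morphism $[f:g]$, and $Z$ is its singular locus (the closed subscheme cut out by the $2M$-th Fitting ideal of $\Omega^1_\varphi$), whose image is the set of $M+1$ distinct points $[a_i:b_i]$. Every $\sigma\in\mathrm{Aut}_X(k)\subset\mathrm{PGL}_{2M+2}(k)$ preserves the pencil $\langle f,g\rangle$ (the span of $f$ and $g$), and $\varphi_*\sigma\in\mathrm{PGL}_2(k)$ is the automorphism of $\mathbb{P}^1_k$ with $\varphi\circ\sigma=(\varphi_*\sigma)\circ\varphi$. *)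

(* Defs.v *)
From HB Require Import structures.
From mathcomp Require Import all_boot all_order all_algebra all_fingroup.
From mathcomp.multinomials Require Export mpoly.

Set Implicit Arguments.
Unset Strict Implicit.
Unset Printing Implicit Defensive.

Import GRing.Theory.
Local Open Scope ring_scope.

(* A k-point of P^(n-1) is given by a nonzero column vector of homogeneous
   coordinates, and an element of PGL_n(k) by an invertible matrix, both up to
   a nonzero scalar.  All the predicates below are invariant under change of
   representative. *)

Section Pencil.
Variable k : fieldType.

(* [u] = [v] as points of projective space *)
Definition eq_proj (n : nat) (u v : 'cV[k]_n) : Prop :=
  [/\ u != 0, v != 0 & exists2 c : k, c != 0 & u = c *: v].

Definition pt2 (s t : k) : 'cV[k]_2 := \col_(i < 2) (if i == 0 then s else t).

Variable n : nat.
Implicit Types (f g : {mpoly k[n]}) (v : 'cV[k]_n).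

Definition evalv f v : k := f.@[fun i => v i 0].

(* k-points of X = V(f, g) *)
Definition inV f g v : Prop := [/\ v != 0, evalv f v = 0 & evalv g v = 0].

(* k-points of the domain P^(n-1) \ X of the morphism [f : g] *)
Definition outV f g v : Prop := v != 0 /\ ~ inV f g v.

Definition phi f g v : 'cV[k]_2 := pt2 (evalv f v) (evalv g v).

(* k-points of the singular locus of phi.  On the chart g != 0 the differential
   of phi is (g df - f dg) / g^2 (and similarly on f != 0).  As P^(n-1) \ X is
   smooth of dimension n - 1, the (n-2)-nd Fitting ideal of the cokernel of
   phi^* Omega_(P^1) -> Omega_(P^(n-1) \ X) is generated by the 1 x 1 minors of
   this map; by Euler's formula (f and g have the same degree) these may be
   computed in homogeneous coordinates. *)
Definition singZ f g v : Prop :=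
  outV f g v /\
  forall i : 'I_n,
    evalv g v * evalv f^`M(i) v - evalv f v * evalv g^`M(i) v = 0.

(* the subset phi(Z) of P^1(k) *)
Definition phiZ f g (p : 'cV[k]_2) : Prop :=
  exists2 v, singZ f g v & eq_proj p (phi f g v).

(* [S] in Aut_X(k), as a subgroup of PGL_n(k): the projective transformation [S]
   maps X onto itself.  When k is algebraically closed and X = V(f, g) is
   reduced, X may be replaced by its set of k-points. *)
Definition autV f g (S : 'M[k]_n) : Prop :=
  S \in unitmx /\ forall v, v != 0 -> inV f g (S *m v) <-> inV f g v.

(* phi_*[S] = [A], that is, phi o [S] = [A] o phi on P^(n-1) \ X *)
Definition phi_push f g (S : 'M[k]_n) (A : 'M[k]_2) : Prop :=
  A \in unitmx /\
  forall v, outV f g v -> eq_proj (phi f g (S *m v)) (A *m phi f g v).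

(* [A] is in the image of phi_* : Aut_X(k) -> PGL_2(k) *)
Definition in_image_phi_push f g (A : 'M[k]_2) : Prop :=
  exists2 S : 'M[k]_n, autV f g S & phi_push f g S A.

End Pencil.

Section Quadrics.
Variables (k : fieldType) (M : nat).

(* homogeneous coordinates [x_0 : ... : x_M : y_0 : ... : y_M] of P^(2M+1) *)
Definition Xc (i : 'I_M.+1) : {mpoly k[M.+1 + M.+1]} := 'X_(lshift M.+1 i).
Definition Yc (i : 'I_M.+1) : {mpoly k[M.+1 + M.+1]} := 'X_(rshift M.+1 i).

Definition quadf (a : 'I_M.+1 -> k) : {mpoly k[M.+1 + M.+1]} :=
  \sum_i a i *: (Xc i * Yc i).

Definition quadg (b : 'I_M.+1 -> k) : {mpoly k[M.+1 + M.+1]} :=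
  \sum_i (b i *: (Xc i * Yc i) + Xc i ^+ 2 + Yc i ^+ 2).

End Quadrics.

(* Main.v *)
(* Write [q = (f, g)] and [V_j] for the plane spanned by the coordinate vectors
   of [x_j] and [y_j].  A lift [S] of [zeta] satisfies [q o S = c A q] with [c]
   constant.  In characteristic 2 the polar form of [b_j f - a_j g] has radical
   [V_j], so [S] maps [V_j] onto [V_(tau j)], and the problem splits into one
   2 x 2 problem per block.  That problem forces the block of [S] to be
   [[p, r], [r, p]] with [p^2 + r^2 = c lambda_j] and
   [a_(tau j) p r = c A_01]; such a block exists exactly when
   [a_(tau j) lambda_j = a_(tau j) A_11 + b_(tau j) A_01].  By the adjugate of
   [A] this equation is condition (1), and it makes every quotient in
   condition (2) equal to [- A_01 / a_(tau j)], so that (2) follows from (1). *)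
Require Import Defs.
From HB Require Import structures.
From mathcomp Require Import all_boot all_order all_algebra all_fingroup.
From mathcomp Require Import ring.

Set Implicit Arguments.
Unset Strict Implicit.
Unset Printing Implicit Defensive.

Import GRing.Theory.
Local Open Scope ring_scope.

(** * Bilinear forms of matrices and the quadratic forms on their diagonal *)

Section QuadraticForms.
Variables (k : fieldType) (n : nat).
Implicit Types (N D : 'M[k]_n) (u v w : 'cV[k]_n).

Definition bform N u v : k := (u^T *m N *m v) 0 0.

Lemma bformDl N u v w : bform N (u + v) w = bform N u w + bform N v w.
Proof. by rewrite /bform linearD !mulmxDl mxE. Qed.

Lemma bformDr N u v w : bform N u (v + w) = bform N u v + bform N u w.
Proof. by rewrite /bform mulmxDr mxE. Qed.

Lemma bformZl N t u v : bform N (t *: u) v = t * bform N u v.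
Proof. by rewrite /bform linearZ -!scalemxAl mxE. Qed.

Lemma bformZr N t u v : bform N u (t *: v) = t * bform N u v.
Proof. by rewrite /bform -!scalemxAr mxE. Qed.

Lemma bform0 N v : bform N 0 v = 0.
Proof. by rewrite /bform trmx0 !mul0mx mxE. Qed.

Lemma bform_delta N i j : bform N (delta_mx i 0) (delta_mx j 0) = N i j.
Proof. by rewrite /bform trmx_delta -rowE -colE !mxE. Qed.

Lemma bform_tr N u v : bform N^T u v = bform N v u.
Proof.
by rewrite /bform -[in RHS](trmxK (v^T *m N *m u)) [in RHS]mxE !trmx_mul trmxK
           mulmxA.
Qed.

Lemma bformDM N D u v : bform (N + D) u v = bform N u v + bform D u v.
Proof. by rewrite /bform mulmxDr mulmxDl mxE. Qed.

Lemma bformZM N t u v : bform (t *: N) u v = t * bform N u v.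
Proof. by rewrite /bform -scalemxAr -scalemxAl mxE. Qed.

Lemma bform_mulmx N (S : 'M_n) u v :
  bform N (S *m u) (S *m v) = bform (S^T *m N *m S) u v.
Proof. by rewrite /bform trmx_mul !mulmxA. Qed.

Lemma bform_polar N u v :
  bform N (u + v) (u + v)
    = bform N u u + bform N v v + (bform N u v + bform N v u).
Proof. by rewrite bformDl !bformDr; ring. Qed.

(** Adding one basis component at a time, each step contributes a diagonal term and a polar term,
    both zero. The diagonal is a separate assumption because in characteristic 2 it does not follow
    from [N + N^T = 0]. *)
Lemma bform_alternating N :
  (forall i, N i i = 0) -> (forall i j, N i j + N j i = 0) ->
  forall v, bform N v v = 0.
Proof.
move=> Nii Nij v.
have polar0 u w : bform N u w + bform N w u = 0.
  rewrite -(bform_tr N u w) -bformDM (_ : N + N^T = 0) ?/bform ?mulmx0 ?mul0mx ?mxE //.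
  by apply/matrixP => i j; rewrite !mxE.
rewrite (matrix_sum_delta v).
elim/big_rec: _ => [|i x _ IH]; first exact: bform0.
by rewrite bform_polar IH polar0 big_ord1 bformZl bformZr bform_delta Nii !mulr0 !addr0.
Qed.

End QuadraticForms.

(** * Gram matrices of f and g, and quadratic forms vanishing on f = 0 *)

Section Split.
Variables (k : fieldType) (m : nat) (a b : 'I_m -> k).
Implicit Types (u v : 'cV[k]_(m + m)) (i j : 'I_m).

(** Upper triangular, not symmetric: in characteristic 2 the form x y is not given by any symmetric
    matrix. *)
Definition fmx : 'M[k]_(m + m) := block_mx 0 (diag_mx (\row_i a i)) 0 0.
Definition gmx : 'M[k]_(m + m) := block_mx 1%:M (diag_mx (\row_i b i)) 0 1%:M.

Notation lc v i := (v (lshift m i) 0).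
Notation rc v i := (v (rshift m i) 0).

Lemma bform_fmx u v : bform fmx u v = \sum_i a i * (lc u i * rc v i).
Proof.
rewrite -[in LHS](vsubmxK u) -[in LHS](vsubmxK v) /bform tr_col_mx.
rewrite mul_row_block mul_row_col.
rewrite !mulmx0 !addr0 mul0mx add0r mxE; apply: eq_bigr => i _.
by rewrite mul_mx_diag !mxE; ring.
Qed.

Lemma bform_gmx u v :
  bform gmx u v = \sum_i (b i * (lc u i * rc v i) + lc u i * lc v i + rc u i * rc v i).
Proof.
rewrite -[in LHS](vsubmxK u) -[in LHS](vsubmxK v) /bform tr_col_mx.
rewrite mul_row_block mul_row_col.
rewrite !mulmx0 !mulmx1 !addr0 mulmxDl !mxE -!big_split; apply: eq_bigr => i _ /=.
by rewrite mul_mx_diag !mxE; ring.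
Qed.

Lemma fmx_ll i j : fmx (lshift m i) (lshift m j) = 0.
Proof. by rewrite block_mxEul mxE. Qed.

Lemma fmx_lr i j : fmx (lshift m i) (rshift m j) = a i *+ (i == j).
Proof. by rewrite block_mxEur !mxE. Qed.

Lemma fmx_rl i j : fmx (rshift m i) (lshift m j) = 0.
Proof. by rewrite block_mxEdl mxE. Qed.

Lemma fmx_rr i j : fmx (rshift m i) (rshift m j) = 0.
Proof. by rewrite block_mxEdr mxE. Qed.

Definition fmxE := (fmx_ll, fmx_lr, fmx_rl, fmx_rr).

(** The form of [N] is tested on explicit zeros of f. Coordinate vectors kill the diagonal, and sums
    of two of them kill every mixed coefficient except those of the x_i y_i. A zero mixing the
    blocks [i0] and [i] makes the latter proportional to the [a i]; the difference from c f is then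
    alternating. *)
Lemma vanish_fmx (i0 : 'I_m) N :
    (forall i, a i != 0) ->
    (forall v, bform fmx v v = 0 -> bform N v v = 0) ->
  exists c, forall v, bform N v v = c * bform fmx v v.
Proof.
move=> a0 hN.
have Nii (i : 'I_(m + m)) : N i i = 0.
  rewrite -bform_delta hN // bform_delta.
  by case: (split_ordP i) => j ->; rewrite !fmxE.
have Nij (i j : 'I_(m + m)) : fmx i j + fmx j i = 0 -> N i j = - N j i.
  move=> fij; apply/eqP; rewrite -addr_eq0; apply/eqP.
  have := hN (delta_mx i 0 + delta_mx j 0).
  rewrite !bform_polar !bform_delta fij !Nii !add0r; apply.
  by case: (split_ordP i) => i' ->; case: (split_ordP j) => j' ->; rewrite !fmxE; ring.
(* [E i] is the coefficient of x_i y_i in the form of [N]. *)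
pose E i := N (lshift m i) (rshift m i) + N (rshift m i) (lshift m i).
have NE i : E i * a i0 = E i0 * a i.
  have [-> // | ii0] := eqVneq i i0.
  have ll : N (lshift m i0) (lshift m i) = - N (lshift m i) (lshift m i0).
    by apply: Nij; rewrite !fmxE addr0.
  have rr : N (rshift m i0) (rshift m i) = - N (rshift m i) (rshift m i0).
    by apply: Nij; rewrite !fmxE addr0.
  have lr : N (lshift m i0) (rshift m i) = - N (rshift m i) (lshift m i0).
    by apply: Nij; rewrite !fmxE eq_sym (negPf ii0) mulr0n addr0.
  have rl : N (rshift m i0) (lshift m i) = - N (lshift m i) (rshift m i0).
    by apply: Nij; rewrite !fmxE (negPf ii0) mulr0n addr0.
  (* This vector lies on f = 0: block [i0] contributes [a i0 * a i] and block [i] its opposite. On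
     it the form of [N] is [a i * E i0 - a i0 * E i]. *)
  have := hN (a i *: delta_mx (lshift m i0) 0 + delta_mx (rshift m i0) 0
              + (delta_mx (lshift m i) 0 - a i0 *: delta_mx (rshift m i) 0)).
  rewrite -scaleNr !(bformDl, bformDr, bformZl, bformZr, bform_delta) !Nii.
  rewrite !fmxE !eqxx eq_sym (negPf ii0) !mulr0n !mulr1n ll rr lr rl => H.
  apply/eqP; rewrite -subr_eq0 -oppr_eq0; apply/eqP.
  by rewrite /E -[RHS]H; ring.
exists (E i0 / a i0) => v.
set c := _ / _.
have NEc i : E i = c * a i by rewrite /c mulrAC -NE mulfK.
apply/eqP; rewrite -subr_eq0 -mulNr -bformZM -bformDM; apply/eqP.
have DE (i j : 'I_(m + m)) : (N + - c *: fmx) i j = N i j - c * fmx i j.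
  by rewrite mxE [X in _ + X]mxE mulNr.
apply: bform_alternating => [i|i j]; rewrite !DE.
  by rewrite Nii; case: (split_ordP i) => j ->; rewrite !fmxE mulr0 subr0.
have -> : N i j - c * fmx i j + (N j i - c * fmx j i)
          = N i j + N j i - c * (fmx i j + fmx j i) by ring.
have [fij|] := eqVneq (fmx i j + fmx j i) 0.
  by rewrite fij (Nij _ _ fij) mulr0 subr0 addNr.
case: (split_ordP i) => i' ->; case: (split_ordP j) => j' ->;
  rewrite !fmxE ?addr0 ?add0r ?eqxx //.
  have [->|] := eqVneq i' j'; last by rewrite mulr0n eqxx.
  by rewrite mulr1n -NEc subrr.
have [->|] := eqVneq j' i'; last by rewrite mulr0n eqxx.
by rewrite mulr1n -NEc /E [in X in X - _]addrC subrr.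
Qed.

End Split.

(** * Density and square roots over an algebraically closed field *)

Section Closed.
Variables (k : closedFieldType) (n : nat).
Implicit Types (N D : 'M[k]_n) (u v w : 'cV[k]_n).

(** If the form of [D] were nonzero at [v], both forms would restrict to nonzero polynomials in t on
    the line u + t v: the constant term of one is [bform N u u], the leading coefficient of the
    other is [bform D v v]. A common nonroot contradicts the assumption. *)
Lemma bform_eq0_dense D N u :
    bform N u u != 0 -> (forall v, bform N v v != 0 -> bform D v v = 0) ->
  forall v, bform D v v = 0.
Proof.
move=> Nu0 DN v; apply/eqP/negP => /negP Dv0.
pose q M : {poly k} := (bform M u u)%:P + (bform M u v + bform M v u) *: 'X
                       + bform M v v *: 'X^2.
have qE M t : (q M).[t] = bform M (u + t *: v) (u + t *: v).
  rewrite /q !(hornerD, hornerZ, hornerC, hornerX, hornerXn).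
  by rewrite bform_polar !(bformZl, bformZr); ring.
have qN0 : q N != 0.
  apply: contraNneq Nu0 => /(congr1 (horner^~ 0)).
  by rewrite qE scale0r addr0 horner0 => ->.
have qD0 : q D != 0.
  apply: contraNneq Dv0 => /(congr1 (coefp 2)).
  by rewrite /q /= !coefE /= mulr0 mulr1 !add0r => ->.
have /closed_nonrootP[t] : q N * q D != 0 by rewrite mulf_neq0.
by rewrite rootM negb_or /root !qE => /andP[Nt]; rewrite DN // eqxx.
Qed.

Lemma root_of_quadratic (c d : k) : exists t, t ^+ 2 = c + d * t.
Proof.
have [t ht] := solve_monicpoly (fun i => if i == 0%N then c else d) (isT : (0 < 2)%N).
by exists t; rewrite ht !big_ord_recl big_ord0 /= expr0 expr1 mulr1 addr0.
Qed.

End Closed.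

(** * The pair q = (f, g) and its behaviour under a lift *)

Section Pencil.
Variables (k : closedFieldType) (M : nat) (a b : 'I_M.+1 -> k).
Hypothesis a_neq0 : forall i, a i != 0.
Implicit Types (S : 'M[k]_(M.+1 + M.+1)) (u v w : 'cV[k]_(M.+1 + M.+1)).
Implicit Types (A : 'M[k]_2) (i j : 'I_M.+1).

Local Notation lc v i := (v (lshift M.+1 i) 0).
Local Notation rc v i := (v (rshift M.+1 i) 0).
Local Notation F := (bform (fmx a)).
Local Notation G := (bform (gmx b)).
Local Notation q v := (pt2 (F v v) (G v v)).

Lemma phiE v : phi (quadf a) (quadg b) v = q v.
Proof.
rewrite /phi /evalv /quadf /quadg !rmorph_sum bform_fmx bform_gmx.
congr pt2; apply: eq_bigr => i _ /=.
  by rewrite mevalZ mevalM !mevalXU.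
by rewrite !mevalD !expr2 mevalZ !mevalM !mevalXU.
Qed.

Lemma inVE v : inV (quadf a) (quadg b) v <-> v != 0 /\ q v = 0.
Proof.
rewrite -phiE /inV /phi; split=> [[v0 -> ->]|[v0 /colP h]].
  by split=> //; apply/colP => i; rewrite !mxE if_same.
by move: (h 0) (h 1); rewrite !mxE.
Qed.

Lemma outVE v : outV (quadf a) (quadg b) v <-> q v != 0.
Proof.
split=> [[v0 hv]|qv0]; first by apply/eqP => qv; apply: hv; apply/inVE.
split; last by case/inVE => _ /eqP; apply/negP.
apply: contraNneq qv0 => ->; rewrite !bform0.
by apply/eqP/colP => i; rewrite !mxE if_same.
Qed.

Lemma q_delta_add i : q (delta_mx (lshift _ i) 0 + delta_mx (rshift _ i) 0) != 0.
Proof.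
apply: contraNneq (a_neq0 i) => /colP/(_ 0); rewrite [LHS]mxE [RHS]mxE /= => <-.
by rewrite bform_polar !bform_delta !fmxE eqxx mulr1n !(add0r, addr0).
Qed.

Lemma mul_pt2 A s t :
  A *m pt2 s t = pt2 (A 0 0 * s + A 0 1 * t) (A 1 0 * s + A 1 1 * t).
Proof.
apply/colP => i; rewrite !mxE big_ord_recl big_ord1 !mxE /=.
have -> : lift ord0 ord0 = 1 :> 'I_2 by apply/val_inj.
have [->|i0] := eqVneq i 0; first by [].
by have -> : i = 1 by case: i i0 => [[|[]]] // ? _; apply/val_inj.
Qed.

Lemma pt2_inj (s t s' t' : k) : pt2 s t = pt2 s' t' -> s = s' /\ t = t'.
Proof. by move=> /colP h; move: (h 0) (h 1); rewrite !mxE. Qed.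

Lemma scale_pt2 (c s t : k) : c *: pt2 s t = pt2 (c * s) (c * t).
Proof. by apply/colP => i; rewrite !mxE; case: ifP. Qed.

(* The scalar relating [(f, g) o S] to [A (f, g)] is a priori a function on
   the complement of X; it is constant because a quadratic form vanishing on
   the quadric f = 0 is a multiple of f. *)
Lemma phi_push_scalar S A :
    autV (quadf a) (quadg b) S -> phi_push (quadf a) (quadg b) S A ->
  exists2 c, c != 0 & forall v, q (S *m v) = c *: (A *m q v).
Proof.
move=> [uS XS] [uA SA].
have pointwise v : exists c, invmx A *m q (S *m v) = c *: q v.
  have [qv0|qv0] := eqVneq (q v) 0; last first.
    have /outVE/SA := qv0; rewrite !phiE => -[_ _ [c c0 ->]].
    by exists c; rewrite -scalemxAr mulKmx.
  exists 0; rewrite scale0r.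
  have [->|v0] := eqVneq v 0.
    rewrite mulmx0 !bform0 mul_pt2 !mulr0 !addr0.
    by apply/colP => i; rewrite !mxE if_same.
  have /(XS _ v0)/inVE[_ ->] : inV (quadf a) (quadg b) v by apply/inVE.
  by rewrite mulmx0.
pose B := invmx A.
(* Gram matrices of the two coordinates of A^(-1) (q o S). *)
pose N (i : 'I_2) := B i 0 *: (S^T *m fmx a *m S) + B i 1 *: (S^T *m gmx b *m S).
have NE v : B *m q (S *m v) = pt2 (bform (N 0) v v) (bform (N 1) v v).
  by rewrite mul_pt2 /N !bformDM !bformZM !bform_mulmx.
have [v|c cF] := vanish_fmx ord0 a_neq0 (N := N 0).
  move=> Fv; have [c] := pointwise v.
  by rewrite -/B NE scale_pt2 Fv mulr0 => /pt2_inj[].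
(* Where f is nonzero, the first coordinate forces the pointwise scalar to be [c], so the second
   agrees with c g there; density extends this to all [v]. *)
have cG v : bform (N 1 + - c *: gmx b) v v = 0.
  move: v; apply: (@bform_eq0_dense _ _ _ (fmx a)
    (delta_mx (lshift _ 0) 0 + delta_mx (rshift _ 0) 0)).
    by rewrite bform_polar !bform_delta !fmxE eqxx mulr1n !(add0r, addr0).
  move=> v Fv; have [c'] := pointwise v.
  rewrite -/B NE scale_pt2 cF => /pt2_inj[/(mulIf Fv) <- NG].
  by rewrite bformDM bformZM NG mulNr subrr.
have qS v : q (S *m v) = c *: (A *m q v).
  apply: (can_inj (mulKmx (_ : B \in unitmx))); first by rewrite unitmx_inv.
  rewrite NE -scalemxAr mulKmx // scale_pt2 cF; congr pt2.
  by apply/eqP; rewrite -subr_eq0 -mulNr -bformZM -bformDM cG.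
(* With c = 0, q o S would vanish identically, hence q too since S is invertible; but q is nonzero
   at the sum of the two coordinate vectors of block 0. *)
exists c => //; apply: contraNneq (q_delta_add 0) => c0.
by rewrite -[X in pt2 (F X X) (G X X)](mulKVmx uS) qS c0 scale0r.
Qed.

(** * Polarization in characteristic 2 *)

Hypothesis char2 : 2%N \in [pchar k].
Hypothesis ab_neq0 : forall i j, i != j -> a i * b j - a j * b i != 0.

Let two_eq0 : 2%:R = 0 :> k.
Proof. exact: pcharf0. Qed.

Local Notation bq u v := (pt2 (F u v + F v u) (G u v + G v u)).

Lemma bq_sym u v : bq u v = bq v u.
Proof. by congr pt2; rewrite addrC. Qed.

Lemma q_polar u v : q (u + v) = q u + q v + bq u v.
Proof. by rewrite !bform_polar; apply/colP => i; rewrite !mxE; case: ifP. Qed.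

(** The squares in g contribute only twice a coordinate, which is zero. Thus pairing with a vector
    of V_j always lands on the line through (a_j, b_j), and it reads off a coordinate of [w]. *)
Lemma bq_delta_l j w :
  bq (delta_mx (lshift _ j) 0) w = rc w j *: pt2 (a j) (b j).
Proof.
rewrite scale_pt2 !bform_fmx !bform_gmx -!big_split; congr pt2.
  rewrite (bigD1 j) //= big1 => [|i ij]; rewrite !mxE !eq_lshift ?eq_rlshift ?eqxx.
    by rewrite /=; ring.
  by rewrite (negPf ij) /=; ring.
rewrite (bigD1 j) //= big1 => [|i ij]; rewrite !mxE !eq_lshift ?eq_rlshift ?eqxx.
  by transitivity (rc w j * b j + 2%:R * lc w j);
    [rewrite /=; ring | rewrite two_eq0; ring].
by rewrite (negPf ij) /=; ring.
Qed.

Lemma bq_delta_r j w :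
  bq (delta_mx (rshift _ j) 0) w = lc w j *: pt2 (a j) (b j).
Proof.
rewrite scale_pt2 !bform_fmx !bform_gmx -!big_split; congr pt2.
  rewrite (bigD1 j) //= big1 => [|i ij]; rewrite !mxE !eq_rshift ?eq_lrshift ?eqxx.
    by rewrite /=; ring.
  by rewrite (negPf ij) /=; ring.
rewrite (bigD1 j) //= big1 => [|i ij]; rewrite !mxE !eq_rshift ?eq_lrshift ?eqxx.
  by transitivity (lc w j * b j + 2%:R * rc w j);
    [rewrite /=; ring | rewrite two_eq0; ring].
by rewrite (negPf ij) /=; ring.
Qed.

Lemma q_delta_l j : q (delta_mx (lshift _ j) 0) = pt2 0 1.
Proof. by rewrite !bform_delta fmx_ll block_mxEul mxE eqxx. Qed.

Lemma q_delta_r j : q (delta_mx (rshift _ j) 0) = pt2 0 1.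
Proof. by rewrite !bform_delta fmx_rr block_mxEdr mxE eqxx. Qed.

(** * Necessity: block structure of a lift *)

Section Image.
Variables (A : 'M[k]_2) (tau : {perm 'I_M.+1}) (lam : 'I_M.+1 -> k).
Hypothesis lam_neq0 : forall i, lam i != 0.
Hypothesis A_ab : forall i,
  A *m pt2 (a i) (b i) = lam i *: pt2 (a (tau i)) (b (tau i)).

Lemma bq_push S c u v :
    (forall w, q (S *m w) = c *: (A *m q w)) ->
  bq (S *m u) (S *m v) = c *: (A *m bq u v).
Proof.
move=> qS.
have bqE x y : bq x y = q (x + y) - (q x + q y).
  by rewrite q_polar [RHS]addrAC subrr add0r.
by rewrite !bqE -mulmxDr !qS mulmxBr mulmxDr scalerBr scalerDr.
Qed.

(** Pairing [S *m u] with a coordinate vector of block [l] gives a coordinate of [S *m u] times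
    (a_l, b_l). It is also a multiple of A (a_j, b_j), hence of (a_(tau j), b_(tau j)). The two
    directions are independent, so the coordinate is zero. *)
Lemma in_block S c u j :
    S \in unitmx -> (forall v, q (S *m v) = c *: (A *m q v)) ->
    (forall w, exists y, bq u w = y *: pt2 (a j) (b j)) ->
  forall l, l != tau j -> lc (S *m u) l = 0 /\ rc (S *m u) l = 0.
Proof.
move=> uS qS uj l ltau.
have aux w x : bq w (S *m u) = x *: pt2 (a l) (b l) -> x = 0.
  rewrite bq_sym -[w](mulKVmx uS) (bq_push _ _ qS).
  have [y ->] := uj (invmx S *m w).
  rewrite -scalemxAr A_ab !scalerA !scale_pt2 => /pt2_inj[h1 h2].
  apply: (mulIf (ab_neq0 ltau)); rewrite mul0r mulrBr !mulrA -h1.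
  by rewrite [x * _ * _]mulrAC -h2; ring.
by split; [apply: aux (bq_delta_r l _) | apply: aux (bq_delta_l l _)].
Qed.

Lemma bq_block u v j :
    (forall l, l != j -> lc u l = 0 /\ rc u l = 0) ->
  F u v = a j * (lc u j * rc v j) /\
  G u v = b j * (lc u j * rc v j) + lc u j * lc v j + rc u j * rc v j.
Proof.
move=> uj; rewrite bform_fmx bform_gmx.
split; rewrite (bigD1 j) //= big1 ?addr0 // => i /uj[ul ur];
  rewrite ul ?ur; ring.
Qed.

(** The block of S has columns (p, r) and (q, z). Equal values of q on them give p r = q z and (p +
    r)^2 = (q + z)^2, so in characteristic 2 the two columns have the same sum and product: they
    agree up to a swap. Equal columns would make the polar value in the last hypothesis 2 s p r = 0,
    so the swap occurs. *)
Lemma block_equations (s t c L be de p q r z : k) :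
    s != 0 -> c != 0 -> L != 0 ->
    s * (p * r) = c * be -> s * (q * z) = c * be ->
    t * (p * r) + p * p + r * r = c * de ->
    t * (q * z) + q * q + z * z = c * de ->
    s * (p * z) + s * (q * r) = c * (L * s) ->
  s * L = s * de + t * be.
Proof.
move=> s0 c0 L0 e1 e2 e3 e4 e5.
have pr : p * r = q * z by apply: (mulfI s0); rewrite e1 e2.
have zE : z = p + r - q.
  apply/eqP; rewrite -subr_eq0 -sqrf_eq0; apply/eqP.
  transitivity ((t * (q * z) + q * q + z * z) - (t * (p * r) + p * p + r * r)
                + t * (p * r - q * z)
                + 2%:R * (p * p + r * r + p * r + q * z - (p + r) * (q + z))).
    by rewrite expr2; ring.
  by rewrite e3 e4 pr two_eq0; ring.
have /eqP : (q - p) * (q - r) = 0.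
  by transitivity (p * r - q * z); [rewrite zE; ring | rewrite pr subrr].
rewrite mulf_eq0 !subr_eq0 => /orP[]/eqP qE.
  have : c * (L * s) == 0.
    rewrite -e5 zE qE; apply/eqP; transitivity (2%:R * (s * p * r)); first by ring.
    by rewrite two_eq0 mul0r.
  by rewrite !mulf_eq0 (negPf c0) (negPf L0) (negPf s0).
apply: (mulfI c0); rewrite [s * L]mulrC -e5.
have -> : c * (s * de + t * be) = s * (c * de) + t * (c * be) by ring.
rewrite -e3 -e1 zE qE.
transitivity (s * (p * p + r * r)); first by ring.
transitivity (s * (p * p + r * r) + 2%:R * (s * t * p * r)); last by ring.
by rewrite two_eq0 mul0r addr0.
Qed.

Lemma scalar_necessary :
    in_image_phi_push (quadf a) (quadg b) A ->
  forall j, a (tau j) * lam j = a (tau j) * A 1 1 + b (tau j) * A 0 1.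
Proof.
move=> [S XS SA] j; have [uS _] := XS.
have [c c0 qS] := phi_push_scalar XS SA.
pose u : 'cV_(M.+1 + M.+1) := S *m delta_mx (lshift _ j) 0.
pose v : 'cV_(M.+1 + M.+1) := S *m delta_mx (rshift _ j) 0.
have uj := in_block uS qS (fun w => ex_intro _ _ (bq_delta_l j w)).
have vj := in_block uS qS (fun w => ex_intro _ _ (bq_delta_r j w)).
have [Fuu Guu] := bq_block u uj; have [Fuv Guv] := bq_block v uj.
have [Fvv Gvv] := bq_block v vj; have [Fvu Gvu] := bq_block u vj.
(* On both coordinate vectors of block [j], (f, g) is (0, 1), so only the second column of [A]
   enters. *)
have [e1 e3] : F u u = c * A 0 1 /\ G u u = c * A 1 1.
  apply: pt2_inj; rewrite qS q_delta_l mul_pt2 scale_pt2.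
  by rewrite !mulr0 !mulr1 !add0r.
have [e2 e4] : F v v = c * A 0 1 /\ G v v = c * A 1 1.
  apply: pt2_inj; rewrite qS q_delta_r mul_pt2 scale_pt2.
  by rewrite !mulr0 !mulr1 !add0r.
have [e5 _] : F u v + F v u = c * (lam j * a (tau j))
              /\ G u v + G v u = c * (lam j * b (tau j)).
  apply: pt2_inj; rewrite -!scale_pt2 -A_ab.
  rewrite (bq_push _ _ qS) bq_delta_l !mxE eqxx scale1r //.
apply: (@block_equations (a (tau j)) (b (tau j)) c (lam j) (A 0 1) (A 1 1)
  (lc u (tau j)) (lc v (tau j)) (rc u (tau j)) (rc v (tau j))) => //.
- by rewrite -e1.
- by rewrite -e2.
- by rewrite -e3.
- by rewrite -e4.
- by rewrite -e5 Fuv Fvu.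
Qed.

(** * Sufficiency: a lift built from blocks, with c = 1 *)

Section Construction.
Variables p r : 'I_M.+1 -> k.

Definition block_map : 'M[k]_(M.+1 + M.+1) :=
  let D d := \matrix_(i, j) (d j *+ (i == tau j)) in
  block_mx (D p) (D r) (D r) (D p).

Lemma block_mapE v j :
  lc (block_map *m v) (tau j) = p j * lc v j + r j * rc v j /\
  rc (block_map *m v) (tau j) = r j * lc v j + p j * rc v j.
Proof.
rewrite -[v in block_map *m v]vsubmxK /block_map mul_block_col col_mxEu col_mxEd.
have DE (d : 'I_M.+1 -> k) (w : 'cV_M.+1) :
    ((\matrix_(i, l) (d l *+ (i == tau l)) : 'M_M.+1) *m w) (tau j) 0 = d j * w j 0.
  rewrite mxE (bigD1 j) //= big1 => [|l lj]; rewrite mxE.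
    by rewrite eqxx mulr1n addr0.
  by rewrite (inj_eq perm_inj) eq_sym (negPf lj) mul0r.
by split; rewrite mxE !DE !mxE.
Qed.

Hypothesis pr_lam : forall j, p j * p j + r j * r j = lam j.

(** In characteristic 2 the square of [[p, r], [r, p]] is (p^2 + r^2) I, here [lam j] times the
    identity; applying each block twice shows that the kernel is zero. *)
Lemma block_map_unit : block_map \in unitmx.
Proof.
rewrite -unitmx_tr -row_free_unit; apply: inj_row_free => w.
move=> /(congr1 trmx); rewrite trmx_mul trmxK trmx0 => Sw.
have w0 j : lc w^T j = 0 /\ rc w^T j = 0.
  have [] := block_mapE w^T j; rewrite Sw !mxE => e1 e2.
  set x := w _ _ in e1 e2 *; set y := w _ _ in e1 e2 *.
  split; apply: (mulfI (lam_neq0 j)); rewrite mulr0 -pr_lam.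
    transitivity (p j * (p j * x + r j * y) + r j * (r j * x + p j * y)
                  - 2%:R * (p j * r j * y)); first by ring.
    by rewrite -e1 -e2 two_eq0; ring.
  transitivity (r j * (p j * x + r j * y) + p j * (r j * x + p j * y)
                - 2%:R * (p j * r j * x)); first by ring.
  by rewrite -e1 -e2 two_eq0; ring.
apply/rowP => i; case: (split_ordP i) => j ->; have [] := w0 j;
  by rewrite !mxE.
Qed.

Hypothesis pr_A01 : forall j, a (tau j) * (p j * r j) = A 0 1.
Hypothesis A_lam : forall j,
  a (tau j) * lam j = a (tau j) * A 1 1 + b (tau j) * A 0 1.

(** After reindexing by [tau], both sides are compared block by block, through the coefficients of x
    y and of x^2 + y^2. The first match by [A_ab], the second by [pr_A01] and [A_lam]. *)
Lemma q_block_map v : q (block_map *m v) = A *m q v.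
Proof.
rewrite mul_pt2 !bform_fmx !bform_gmx !mulr_sumr -!big_split.
congr pt2; rewrite (reindex_inj (@perm_inj _ tau)); apply: eq_bigr => j _ /=;
  have [-> ->] := block_mapE v j; have := A_ab j;
  rewrite mul_pt2 scale_pt2 => /pt2_inj[h0 h1];
  set x := lc v j; set y := rc v j.
  transitivity ((A 0 0 * a j + A 0 1 * b j) * (x * y) + A 0 1 * (x * x + y * y)).
    by rewrite h0 -pr_lam -(pr_A01 j); ring.
  ring.
have A11 : A 1 1 = lam j + b (tau j) * (p j * r j).
  apply: (mulfI (a_neq0 (tau j))).
  rewrite mulrDr A_lam -(pr_A01 j).
  transitivity (a (tau j) * A 1 1 + 2%:R * (a (tau j) * b (tau j) * (p j * r j))).
    by rewrite two_eq0; ring.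
  ring.
transitivity ((A 1 0 * a j + A 1 1 * b j) * (x * y) + A 1 1 * (x * x + y * y)).
  rewrite h1 A11 -pr_lam.
  transitivity ((p j * p j + r j * r j) * b (tau j) * (x * y) +
    (p j * p j + r j * r j + b (tau j) * (p j * r j)) * (x * x + y * y)
    + 2%:R * (2%:R * p j * r j * x * y)); first by ring.
  by rewrite two_eq0; ring.
ring.
Qed.

End Construction.

Hypothesis A_unit : A \in unitmx.

Lemma scalar_sufficient :
    (forall j, a (tau j) * lam j = a (tau j) * A 1 1 + b (tau j) * A 0 1) ->
  in_image_phi_push (quadf a) (quadg b) A.
Proof.
move=> A_lam.
(* [p j] and [r j] are the roots of [t^2 + sqrt (lam j) t + A 0 1 / a (tau j)]. *)
have [p [r pr_lam pr_A01]] : exists p, exists2 r : 'I_M.+1 -> k,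
    forall j, p j * p j + r j * r j = lam j & forall j, a (tau j) * (p j * r j) = A 0 1.
  suff /fin_all_exists[pr h] : forall j, exists x : k * k,
      x.1 * x.1 + x.2 * x.2 = lam j /\ a (tau j) * (x.1 * x.2) = A 0 1.
    by exists (fun j => (pr j).1), (fun j => (pr j).2) => j; case: (h j).
  move=> j; have [n nE] := root_of_quadratic (lam j) 0.
  have [t tE] := root_of_quadratic (- (A 0 1 / a (tau j))) n.
  exists (t, n - t) => /=.
  have tn : t * (n - t) = A 0 1 / a (tau j).
    by transitivity (t * n - t ^+ 2); [ring | rewrite tE; ring].
  split; last by rewrite tn mulrCA divff ?mulr1.
  transitivity (n ^+ 2 - 2%:R * (t * (n - t))); first by ring.
  by rewrite nE two_eq0 !mul0r subr0 addr0.
have qS := q_block_map pr_lam pr_A01 A_lam.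
have uS := block_map_unit pr_lam.
have SI S v : S \in unitmx -> S *m v != 0 <-> v != 0.
  move=> US; split; first by apply: contraNneq => ->; rewrite mulmx0.
  by apply: contraNneq => Sv; rewrite -[v](mulKmx US) Sv mulmx0.
have AI (x : 'cV_2) : A *m x = 0 <-> x = 0.
  by split=> [Ax|->]; rewrite ?mulmx0 // -[x](mulKmx A_unit) Ax mulmx0.
exists (block_map p r); split=> // v.
  by move=> v0; rewrite !inVE qS SI // AI.
move=> /outVE qv0; rewrite !phiE qS.
have Aq0 : A *m q v != 0 by apply: contraNneq qv0 => /AI->.
by split=> //; exists 1; rewrite ?oner_eq0 ?scale1r.
Qed.

(** * From the block equation to conditions (1) and (2) *)

Lemma det_condition j :
  a (tau j) * lam j = a (tau j) * A 1 1 + b (tau j) * A 0 1 <->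
  \det A = a (tau j) * lam j ^+ 2 / a j.
Proof.
have := A_ab j; rewrite mul_pt2 scale_pt2 => /pt2_inj[h0 h1].
have detA : \det A * a j = lam j * (a (tau j) * A 1 1 + b (tau j) * A 0 1).
  (* The first row of adj(A) A = det(A) I, applied to (a_j, b_j); the minus sign is then absorbed in
     characteristic 2. *)
  transitivity (A 1 1 * (A 0 0 * a j + A 0 1 * b j)
                - A 0 1 * (A 1 0 * a j + A 1 1 * b j)).
    rewrite (expand_det_row A 0) !big_ord_recl big_ord0 /cofactor !det_mx11 !mxE /=.
    have -> : lift 0 0 = 1 :> 'I_2 by apply/val_inj.
    have -> : lift 1 0 = 0 :> 'I_2 by apply/val_inj.
    by ring.
  rewrite h0 h1.
  transitivity (lam j * (a (tau j) * A 1 1 + b (tau j) * A 0 1)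
                - 2%:R * (lam j * b (tau j) * A 0 1)); first by ring.
  by rewrite two_eq0 mul0r subr0.
split=> [e|e].
  by apply: (mulIf (a_neq0 j)); rewrite divfK // detA -e; ring.
apply: (mulfI (lam_neq0 j)); rewrite -detA e divfK //; ring.
Qed.

(** Eliminating [A 1 1] between the block equations of [i] and [j] leaves [A 0 1] times the opposite
    of the denominator. *)
Lemma quotient_condition i j :
    (forall l, a (tau l) * lam l = a (tau l) * A 1 1 + b (tau l) * A 0 1) ->
    i != j ->
  a (tau i) * (lam i - lam j) / (a (tau i) * b (tau j) - a (tau j) * b (tau i))
  = - (A 0 1 / a (tau j)).
Proof.
move=> A_lam ij.
have d0 : a (tau i) * b (tau j) - a (tau j) * b (tau i) != 0.
  by rewrite ab_neq0 // (inj_eq perm_inj).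
apply: (mulIf d0); rewrite divfK //; apply: (mulfI (a_neq0 (tau j))).
transitivity (a (tau j) * (a (tau i) * lam i) - a (tau i) * (a (tau j) * lam j)).
  by ring.
by rewrite !A_lam; field.
Qed.

End Image.

End Pencil.

Theorem theorem4p3 (k : closedFieldType) (hchar : 2%N \in [pchar k])
    (M : nat) (hM : (2 <= M)%N)
    (a b : 'I_M.+1 -> k)
    (ha : forall i, a i != 0)
    (hab : forall i j, i != j -> a i * b j - a j * b i != 0)
    (A : 'M[k]_2) (hA : A \in unitmx)
    (hZ : forall p : 'cV[k]_2, p != 0 ->
       phiZ (quadf a) (quadg b) (A *m p) <-> phiZ (quadf a) (quadg b) p)
    (tau : {perm 'I_M.+1})
    (htau : forall i,
       eq_proj (A *m pt2 (a i) (b i)) (pt2 (a (tau i)) (b (tau i))))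
    (lam : 'I_M.+1 -> k)
    (hlam0 : forall i, lam i != 0)
    (hlam : forall i,
       A *m pt2 (a i) (b i) = lam i *: pt2 (a (tau i)) (b (tau i))) :
  in_image_phi_push (quadf a) (quadg b) A <->
  (forall i, \det A = a (tau i) * lam i ^+ 2 / a i) /\
  (forall j i i', i != j -> i' != j ->
     a (tau i) * (lam i - lam j)
       / (a (tau i) * b (tau j) - a (tau j) * b (tau i)) =
     a (tau i') * (lam i' - lam j)
       / (a (tau i') * b (tau j) - a (tau j) * b (tau i'))).
Proof.
have detE j := det_condition ha hchar hlam0 hlam j.
split=> [img|[cond1 _]].
  have A_lam := scalar_necessary ha hchar hab hlam0 hlam img.
  split=> [i|j i i' ij i'j]; first exact/detE.
  by rewrite !(quotient_condition ha hab A_lam).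
by apply: (scalar_sufficient ha hchar hlam0 hlam hA) => j; apply/detE.
Qed.
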